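(* Let $z$ be a complex number with $|z|<1$. Then $$\prod_{\substack{m,n \geq 1 \\ m \leq n,\ \gcd(m,n)=1}} \left( \frac{1}{1-z^n} \right)^{\frac{m^2}{n^3}} = \sqrt{\frac{1}{1-z}}\; \exp\left\{\frac{1}{6} Li_2(z) + \frac{1}{3}\,\frac{z}{1-z} \right\},$$ and $$\prod_{\substack{m,n \geq 1 \\ m \leq n,\ \gcd(m,n)=1}} \left( 1-z^n\right)^{\frac{m^2}{n^3}} = \sqrt{1-z}\; \exp\left\{-\frac{1}{6} Li_2(z) - \frac{1}{3}\,\frac{z}{1-z} \right\}.$$
   Context: The products run over all pairs of positive integers $(m,n)$ with $m\le n$ and $\gcd(m,n)=1$. $Li_2(z)=\sum_{r\ge1} z^r/r^2$ is the dilogarithm. Complex powers are taken with the principal branch, i.e. $(1-w)^{\alpha}=\exp(\alpha\log(1-w))$ with the principal logarithm. *)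

(* Defs.v *)
From Stdlib Require Import Reals List Arith Lia Lra.
From Coquelicot Require Import Coquelicot.
Open Scope R_scope.

Definition Cexp (w : C) : C := (exp (Re w) * cos (Im w), exp (Re w) * sin (Im w)).

(* Principal argument, in (-PI, PI]; the value at 0 is junk. *)
Definition Carg (w : C) : R :=
  if Rle_dec 0 (Im w) then acos (Re w / Cmod w) else - acos (Re w / Cmod w).

Definition Clog (w : C) : C := (ln (Cmod w), Carg w).

(* Principal branch; only meaningful for w <> 0. *)
Definition Cpower (w a : C) : C := Cexp (a * Clog w)%C.

Definition Csqrt (w : C) : C := Cpower w (RtoC (1 / 2)).

Definition Li2_term (z : C) (k : nat) : C := (z ^ S k / RtoC (INR (S k)) ^ 2)%C.

(* The series is indexed from k = 0, so r = k + 1. *)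
Definition Li2 (z : C) : C :=
  @iota C_CompleteNormedModule (fun l : C => is_series (Li2_term z) l).

Definition list_Cprod {T : Type} (f : T -> C) (L : list T) : C :=
  fold_right (fun t p => f t * p)%C (RtoC 1) L.

(* Finite subsets of A, directed by inclusion; a finite subset is encoded by
   any of its duplicate-free enumerations. *)
Definition finite_subsets {T : Type} (A : T -> Prop) (Q : list T -> Prop) : Prop :=
  exists L0 : list T, List.Forall A L0 /\
    forall L : list T, NoDup L -> List.Forall A L -> incl L0 L -> Q L.

(* The product of f over the set A, in no prescribed order (unconditional
   convergence), equals P. *)
Definition is_prod {T : Type} (A : T -> Prop) (f : T -> C) (P : C) : Prop :=
  filterlim (list_Cprod f) (finite_subsets A) (locally P).

Definition coprime_pair (p : nat * nat) : Prop :=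
  let (m, n) := p in
  (1 <= m)%nat /\ (1 <= n)%nat /\ (m <= n)%nat /\ Nat.gcd m n = 1%nat.

Lemma Carg_bound (w : C) (hw : w <> RtoC 0) : - PI < Carg w <= PI.
Proof.
unfold Carg; pose proof (acos_bound (Re w / Cmod w)) as [H0 H1].
pose proof PI_RGT_0 as Hpi.
destruct (Rle_dec 0 (Im w)) as [Hi|Hi]; [lra|].
split; [|lra].
assert (Hm : 0 < Cmod w) by now apply Cmod_gt_0.
enough (acos (Re w / Cmod w) <> PI) by lra.
intros Habs.
assert (Hb : -1 <= Re w / Cmod w <= 1).
{ pose proof (Rmax_Cmod w) as HM.
  assert (Hr : Rabs (Re w) <= Cmod w) by (eapply Rle_trans; [apply Rmax_l|exact HM]).
  apply Rabs_le_between in Hr.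
  split; [apply Rle_div_r|apply Rle_div_l]; lra. }
assert (Hc : Re w / Cmod w = -1) by (rewrite <- (cos_acos _ Hb), Habs; apply cos_PI).
assert (Hre : Re w = - Cmod w).
{ replace (Re w) with (Re w / Cmod w * Cmod w) by (field; lra). rewrite Hc; ring. }
assert (Hsq : Cmod w ^ 2 = Re w ^ 2 + Im w ^ 2).
{ unfold Cmod; rewrite pow2_sqrt; [reflexivity|]; nra. }
rewrite Hre in Hsq; nra.
Qed.

Lemma Cexp_Clog (w : C) (hw : w <> RtoC 0) : Cexp (Clog w) = w.
Proof.
assert (Hm : 0 < Cmod w) by now apply Cmod_gt_0.
assert (Hb : -1 <= Re w / Cmod w <= 1).
{ pose proof (Rmax_Cmod w) as HM.
  assert (Hr : Rabs (Re w) <= Cmod w) by (eapply Rle_trans; [apply Rmax_l|exact HM]).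
  apply Rabs_le_between in Hr.
  split; [apply Rle_div_r|apply Rle_div_l]; lra. }
assert (Hsq : Cmod w ^ 2 = Re w ^ 2 + Im w ^ 2).
{ unfold Cmod; rewrite pow2_sqrt; [reflexivity|]; nra. }
assert (Hs : Cmod w * sin (acos (Re w / Cmod w)) = Rabs (Im w)).
{ rewrite sin_acos by assumption.
  rewrite <- (sqrt_Rsqr (Cmod w)) at 1 by lra.
  rewrite <- sqrt_mult_alt by apply Rle_0_sqr.
  rewrite <- sqrt_Rsqr_abs; f_equal; unfold Rsqr.
  transitivity (Cmod w ^ 2 - Re w ^ 2); [field; lra|rewrite Hsq; ring]. }
unfold Cexp, Clog, Carg; simpl.
rewrite exp_ln by assumption.
destruct w as [x y]; simpl in *.
destruct (Rle_dec 0 y) as [Hi|Hi]; apply injective_projections; simpl.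
- rewrite cos_acos by assumption; field; lra.
- rewrite Hs; now apply Rabs_pos_eq.
- rewrite cos_neg, cos_acos by assumption; field; lra.
- rewrite sin_neg, Ropp_mult_distr_r_reverse, Hs, Rabs_left; lra.
Qed.

Lemma is_series_Li2 (z : C) (hz : Cmod z < 1) : is_series (Li2_term z) (Li2 z).
Proof.
assert (Hex : @ex_series C_AbsRing C_NormedModule (Li2_term z)).
{ apply (@ex_series_le C_AbsRing C_CompleteNormedModule _ (fun k => Cmod z ^ k)).
  - intros k. change (Cmod (Li2_term z k) <= Cmod z ^ k).
    pose proof (Cmod_ge_0 z) as H0.
    assert (Hk : 1 <= INR (S k)) by (rewrite S_INR; pose proof (pos_INR k); lra).
    assert (Hn : RtoC (INR (S k)) <> RtoC 0) by (intros E; apply RtoC_inj in E; lra).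
    unfold Li2_term; rewrite Cmod_div by now apply Cpow_nz.
    rewrite !Cmod_pow, Cmod_R, Rabs_pos_eq by lra.
    pose proof (pow_le _ k H0) as Hp.
    assert (Hsq : 1 <= INR (S k) ^ 2) by now apply pow_R1_Rle.
    apply Rle_div_l; [lra|].
    change (Cmod z ^ S k) with (Cmod z * Cmod z ^ k).
    apply Rle_trans with (Cmod z ^ k * 1); [nra|].
    now apply Rmult_le_compat_l.
  - apply ex_series_geom; rewrite Rabs_pos_eq; [exact hz|apply Cmod_ge_0]. }
destruct Hex as [l Hl].
assert (E : Li2 z = l).
{ exact (@iota_filterlim_locally C_AbsRing C_CompleteNormedModule _ _
    (Proper_StrongProper _ eventually_filter) (sum_n (Li2_term z)) l Hl). }
now rewrite E.
Qed.

Global Instance finite_subsets_filter {T : Type} (A : T -> Prop) :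
  Filter (finite_subsets A).
Proof.
split.
- exists nil; split; [constructor|auto].
- intros P Q [L1 [H1 HP]] [L2 [H2 HQ]]; exists (L1 ++ L2); split.
  + now apply List.Forall_app.
  + intros L ND HL Hi; apply incl_app_inv in Hi; destruct Hi; auto.
- intros P Q HPQ [L0 [H0 HP]]; exists L0; auto.
Qed.

Lemma finite_subsets_proper {T : Type} (A : T -> Prop)
  (dec : forall x y : T, {x = y} + {x <> y}) : ProperFilter (finite_subsets A).
Proof.
split; [|apply finite_subsets_filter].
intros P [L0 [H0 HP]]; exists (nodup dec L0); apply HP.
- apply NoDup_nodup.
- apply List.Forall_forall; intros x Hx; apply nodup_In in Hx.
  now apply (proj1 (List.Forall_forall A L0) H0).
- intros x Hx; now apply nodup_In.
Qed.

(* Main.v *)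
Require Import Defs.
From Stdlib Require Import Reals Lra Lia List Arith.
From Coquelicot Require Import Coquelicot.
Open Scope R_scope.

(* Since -log(1 - z^n) = sum_k z^(nk)/k, the logarithm of the first product is the sum
   over coprime pairs (m, n) and k >= 1 of (mk)^2/(nk)^3 z^(nk). Every lattice point
   (a, N) with 1 <= a <= N is (mk, nk) for exactly one such triple, so this is
   sum_N z^N/N^3 sum_(a <= N) a^2, and sum_(a <= N) a^2 / N^3 = 1/3 + 1/(2N) + 1/(6N^2).
   For unconditional convergence: once a finite set of coprime pairs contains all
   those with n <= K, its partial sum differs from the total only in levels N > K, and
   level N contributes at most |z|^N. *)

(** * Convergence by real and imaginary parts; termwise integration of power series *)

Lemma Re_sum_n (a : nat -> C) (n : nat) :
  Re (@sum_n C_NormedModule a n) = sum_n (fun k => Re (a k)) n.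
Proof.
induction n as [|n IH]; [now rewrite !sum_O|].
rewrite !sum_Sn, <- IH; reflexivity.
Qed.

Lemma Im_sum_n (a : nat -> C) (n : nat) :
  Im (@sum_n C_NormedModule a n) = sum_n (fun k => Im (a k)) n.
Proof.
induction n as [|n IH]; [now rewrite !sum_O|].
rewrite !sum_Sn, <- IH; reflexivity.
Qed.

(** The uniform structure on [C] is that of the product, so a ball is a product of two real balls of
    the same radius. *)
Lemma filterlim_C_components {T : Type} (F : (T -> Prop) -> Prop) {FF : Filter F}
  (f : T -> C) (l : C) :
  filterlim (fun x => Re (f x)) F (locally (Re l)) ->
  filterlim (fun x => Im (f x)) F (locally (Im l)) ->
  filterlim f F (locally l).
Proof.
intros H1 H2.
apply filterlim_locally; intros eps.
pose proof (proj1 (filterlim_locally _ _) H1 eps) as E1.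
pose proof (proj1 (filterlim_locally _ _) H2 eps) as E2.
generalize (filter_and _ _ E1 E2); apply filter_imp; intros x [B1 B2].
now split.
Qed.

Lemma is_series_C_components (a : nat -> C) (l : C) :
  is_series (fun k => Re (a k)) (Re l) ->
  is_series (fun k => Im (a k)) (Im l) ->
  @is_series C_AbsRing C_NormedModule a l.
Proof.
intros H1 H2.
apply (filterlim_C_components eventually (sum_n a) l).
- eapply filterlim_ext; [|exact H1]; intros n; now rewrite Re_sum_n.
- eapply filterlim_ext; [|exact H2]; intros n; now rewrite Im_sum_n.
Qed.

(* By the mean value theorem on [0, 1], a geometric bound on the remainders of the
   derivative passes to the primitive, without differentiating a power series. *)
Lemma is_series_taylor (a da : R -> R) (c : nat -> R) (B r : R) (hr : 0 <= r < 1) :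
  a 0 = 0 ->
  (forall t, Rabs t <= 1 -> is_derive a t (da t)) ->
  (forall n t, Rabs t <= 1 ->
     Rabs (da t - sum_n (fun k => c k * t ^ k) n) <= B * r ^ n) ->
  is_series (fun k => c k / INR (S k)) (a 1).
Proof.
intros ha0 hda hB.
set (P := fun (n : nat) (t : R) => sum_n (fun k => c k / INR (S k) * t ^ S k) n : R).
assert (HP : forall n t, is_derive (P n) t (sum_n (fun k => c k * t ^ k) n)).
{ intros n t; unfold P.
  apply (is_derive_sum_n (fun k u => c k / INR (S k) * u ^ S k)).
  intros k _; auto_derive; [trivial|].
  change (pred (S k)) with k.
  pose proof (not_0_INR (S k) (Nat.neq_succ_0 k)) as Hk.
  simpl pred; field; exact Hk. }
assert (HE : forall n, Rabs (P n 1 - a 1) <= B * r ^ n).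
{ intros n.
  assert (HP0 : P n 0 = 0).
  { unfold P; induction n as [|n IH]; [rewrite sum_O; simpl; ring|].
    rewrite sum_Sn, IH; unfold plus; simpl; ring. }
  pose proof (bounded_variation (fun t => a t - P n t)
    (fun t => da t - sum_n (fun k => c k * t ^ k) n) (B * r ^ n) 0 1) as HV.
  cbv beta in HV; rewrite ha0, HP0, (Rminus_0_r 1), Rabs_R1 in HV.
  rewrite Rabs_minus_sym.
  replace (a 1 - P n 1) with (a 1 - P n 1 - (0 - 0)) by ring.
  rewrite <- (Rmult_1_r (B * r ^ n)); apply HV.
  intros t Ht; rewrite Rminus_0_r in Ht; split; [|now apply hB].
  apply (is_derive_minus a (P n)); [now apply hda|apply HP]. }
change (is_lim_seq (sum_n (fun k => c k / INR (S k))) (a 1)).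
apply (is_lim_seq_ext (fun n => (P n 1 - a 1) + a 1)).
{ intros n; transitivity (P n 1); [ring|unfold P].
  apply sum_n_ext; intros k; rewrite pow1; apply Rmult_1_r. }
evar_last.
{ apply is_lim_seq_plus'; [|apply is_lim_seq_const].
  apply (is_lim_seq_abs_0 (fun n => P n 1 - a 1)).
  apply (is_lim_seq_le_le (fun _ => 0) _ (fun n => B * r ^ n)).
  - intros n; split; [apply Rabs_pos|apply HE].
  - apply is_lim_seq_const.
  - evar_last; [apply is_lim_seq_scal_l, is_lim_seq_geom; rewrite Rabs_pos_eq; lra|].
    simpl; now rewrite Rmult_0_r. }
simpl; f_equal; ring.
Qed.

(** * The principal logarithm and its power series *)

(** Replaces the case split in [Carg] by a single formula that can be differentiated along rays. *)
Lemma Carg_atan (w : C) (hw : 0 < Re w) : Carg w = atan (Im w / Re w).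
Proof.
destruct w as [x y]; unfold Carg; cbn in *.
assert (Hc : x / Cmod (x, y) = cos (atan (y / x))).
{ rewrite cos_atan; unfold Cmod; simpl fst; simpl snd.
  replace (x ^ 2 + y ^ 2) with (x ^ 2 * (1 + (y / x)²)) by (unfold Rsqr; field; lra).
  rewrite sqrt_mult_alt, sqrt_pow2 by nra.
  assert (0 < sqrt (1 + (y / x)²)) by (apply sqrt_lt_R0; pose proof (Rle_0_sqr (y/x)); lra).
  field; lra. }
rewrite Hc.
pose proof (atan_bound (y / x)) as Hb; pose proof PI_RGT_0.
assert (Hix : 0 < / x) by now apply Rinv_0_lt_compat.
(* On this range [acos (cos t)] is the absolute value of t. Since x > 0, [atan (y / x)] has the sign
   of y, which is the sign that [Carg] restores. *)
destruct (Rle_dec 0 y) as [Hy|Hy].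
- apply acos_cos; split; [|lra].
  rewrite <- atan_0; destruct (Req_dec (y / x) 0) as [->|Hn]; [lra|].
  apply Rlt_le, atan_increasing.
  assert (0 <= y / x) by (apply Rmult_le_pos; lra); lra.
- assert (y / x < 0) by (unfold Rdiv; nra).
  assert (atan (y / x) < 0) by (rewrite <- atan_0; now apply atan_increasing).
  rewrite <- cos_neg, acos_cos; lra.
Qed.

(** Inversion preserves the right half-plane, where the argument is [atan (Im w / Re w)]; inversion
    changes the sign of that quotient and [atan] is odd. This links the two products. *)
Lemma Clog_inv (w : C) (hw : 0 < Re w) : Clog (1 / w) = (- Clog w)%C.
Proof.
assert (Hw : w <> RtoC 0) by (intros ->; simpl in hw; lra).
assert (Hm : 0 < Cmod w) by now apply Cmod_gt_0.
assert (HD : 0 < Re w ^ 2 + Im w ^ 2) by nra.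
assert (HR : Re (1 / w)%C = Re w / (Re w ^ 2 + Im w ^ 2))
  by (destruct w; simpl in *; field; lra).
assert (HI : Im (1 / w)%C = - Im w / (Re w ^ 2 + Im w ^ 2))
  by (destruct w; simpl in *; field; lra).
unfold Clog; rewrite !Carg_atan; [|assumption|rewrite HR; now apply Rdiv_lt_0_compat].
rewrite HR, HI.
apply injective_projections; simpl.
- rewrite Cmod_div, Cmod_1 by assumption.
  replace (1 / Cmod w) with (/ Cmod w) by (field; lra).
  now apply ln_Rinv.
- rewrite <- atan_opp; f_equal; field; split; lra.
Qed.

Lemma Rabs_Re_le_Cmod (w : C) : Rabs (Re w) <= Cmod w.
Proof. eapply Rle_trans; [apply Rmax_l|apply Rmax_Cmod]. Qed.

Lemma Rabs_Im_le_Cmod (w : C) : Rabs (Im w) <= Cmod w.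
Proof. eapply Rle_trans; [apply Rmax_r|apply Rmax_Cmod]. Qed.

Lemma Re_1_minus_pos (w : C) (hw : Cmod w < 1) : 0 < Re (1 - w)%C.
Proof.
pose proof (Rabs_Re_le_Cmod w) as H; apply Rabs_le_between in H.
destruct w; simpl in *; lra.
Qed.

(** Cleared of its denominator, this serves both the remainder estimate along the ray t w and, at t
    = 1, the geometric series. *)
Lemma Cgeom_sum_n (w : C) (t : R) (n : nat) :
  ((1 - t * w) * @sum_n C_NormedModule (fun k => w ^ S k * RtoC (t ^ k))%C n
   = w - w * (t * w) ^ S n)%C.
Proof.
induction n as [|n IH]; [rewrite sum_O; simpl; ring|].
rewrite sum_Sn; change plus with Cplus.
rewrite Cmult_plus_distr_l, IH, !Cpow_mult_l, RtoC_pow; simpl; ring.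
Qed.

(** The real part of the identity d/du (-log(1 - u w)) = w / (1 - u w); [is_derive_atan_ray] is the
    imaginary part. *)
Lemma is_derive_ln_Cmod_ray (w : C) (t : R) (ht : 0 < Re (1 - t * w)%C) :
  is_derive (fun u : R => - ln (Cmod (1 - u * w))) t (Re (w / (1 - t * w))%C).
Proof.
destruct w as [x y].
assert (ht' : 0 < 1 - t * x) by (simpl in ht; lra).
assert (HD : 0 < (1 - t * x) * (1 - t * x) + t * y * (t * y)) by nra.
(* Half the logarithm of the squared modulus avoids differentiating the square root. The two forms
   are compared only near t, where the squared modulus stays positive. *)
apply (is_derive_ext_loc
  (fun u => - / 2 * ln ((1 - u * x) * (1 - u * x) + u * y * (u * y)))).
- assert (HC : continuous (fun u => (1 - u * x) * (1 - u * x) + u * y * (u * y)) t).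
  { apply (ex_derive_continuous (fun u => (1 - u * x) * (1 - u * x) + u * y * (u * y))).
    auto_derive; trivial. }
  generalize (HC _ (open_gt 0 _ HD) : locally t _); apply filter_imp; intros u Hu.
  unfold Cmod; simpl fst; simpl snd.
  replace ((1 + - (u * x - 0 * y)) ^ 2 + (0 + - (u * y + 0 * x)) ^ 2)
    with ((1 - u * x) * (1 - u * x) + u * y * (u * y)) by ring.
  set (D := (1 - u * x) * (1 - u * x) + u * y * (u * y)) in *.
  rewrite <- (sqrt_sqrt D) at 1 by lra.
  rewrite ln_mult by now apply sqrt_lt_R0.
  change (- / 2 * (ln (sqrt D) + ln (sqrt D)) = - ln (sqrt D) :> R); field.
- auto_derive; [exact HD|].
  simpl; field; nra.
Qed.

Lemma is_derive_atan_ray (w : C) (t : R) (ht : 0 < Re (1 - t * w)%C) :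
  is_derive (fun u : R => - atan (Im (1 - u * w) / Re (1 - u * w)))
    t (Im (w / (1 - t * w))%C).
Proof.
destruct w as [x y].
assert (ht' : 0 < 1 - t * x) by (simpl in ht; lra).
assert (HD : 0 < (1 - t * x) * (1 - t * x) + t * y * (t * y)) by nra.
simpl; auto_derive; [lra|].
unfold Rsqr; field; repeat split; nra.
Qed.

(** Expand w / (1 - t w) geometrically and integrate over t from 0 to 1, for each component
    separately. *)
Lemma is_series_Clog (w : C) (hw : Cmod w < 1) :
  @is_series C_AbsRing C_NormedModule
    (fun k => w ^ S k / RtoC (INR (S k)))%C (- Clog (1 - w))%C.
Proof.
pose proof (Cmod_ge_0 w) as Hw0.
set (dl := fun t : R => (w / (1 - t * w))%C).
assert (Htw : forall t, Rabs t <= 1 -> Cmod (t * w) <= Cmod w).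
{ intros t Ht; rewrite Cmod_mult, Cmod_R; nra. }
assert (Hpos : forall t, Rabs t <= 1 -> 0 < Re (1 - t * w)%C).
{ intros t Ht; apply Re_1_minus_pos; specialize (Htw t Ht); lra. }
(* The remainder is w (t w)^(n+1) / (1 - t w). Its denominator has modulus at least 1 - |w|, and
   surplus factors of modulus below 1 in the numerator are dropped. *)
assert (Hrem : forall n t, Rabs t <= 1 ->
  Cmod (dl t - @sum_n C_NormedModule (fun k => w ^ S k * RtoC (t ^ k))%C n)
    <= / (1 - Cmod w) * Cmod w ^ n).
{ intros n t Ht; specialize (Htw t Ht).
  assert (Hn : (1 - t * w)%C <> RtoC 0)
    by (specialize (Hpos t Ht); intros E; rewrite E in Hpos; simpl in Hpos; lra).
  set (s := sum_n _ n).
  replace (dl t - s)%C with (w * (t * w) ^ S n / (1 - t * w))%C.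
  2:{ replace s with ((w - w * (t * w) ^ S n) / (1 - t * w))%C.
      - unfold dl; field; exact Hn.
      - unfold s; rewrite <- Cgeom_sum_n; field; exact Hn. }
  rewrite Cmod_div, Cmod_mult, Cmod_pow by exact Hn.
  assert (Hd : 1 - Cmod w <= Cmod (1 - t * w)).
  { pose proof (Cmod_triangle (1 - t * w) (t * w)) as HT.
    replace (1 - t * w + t * w)%C with (RtoC 1) in HT by ring.
    rewrite Cmod_1 in HT; lra. }
  unfold Rdiv; rewrite (Rmult_comm (/ (1 - Cmod w))); apply Rmult_le_compat.
  - apply Rmult_le_pos; [lra|apply pow_le, Cmod_ge_0].
  - apply Rlt_le, Rinv_0_lt_compat; lra.
  - pose proof (pow_le _ n (Cmod_ge_0 (t * w))).
    pose proof (pow_incr _ _ n (conj (Cmod_ge_0 (t * w)) Htw)).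
    change (Cmod (t * w) ^ S n) with (Cmod (t * w) * Cmod (t * w) ^ n).
    pose proof (Cmod_ge_0 (t * w)).
    assert (Cmod (t * w) * Cmod (t * w) ^ n <= Cmod (t * w) ^ n) by nra.
    nra.
  - apply Rinv_le_contravar; lra. }
assert (Hc : forall k, (w ^ S k / RtoC (INR (S k)) = w ^ S k * RtoC (/ INR (S k)))%C).
{ intros k; rewrite RtoC_inv; [reflexivity|]; now apply not_0_INR. }
set (f := fun t : R => - ln (Cmod (1 - t * w))).
set (g := fun t : R => - atan (Im (1 - t * w) / Re (1 - t * w))).
(* [f] and [g] are the components of -log(1 - t w): they vanish at t = 0, and their values at t = 1
   form the required sum. *)
replace (- Clog (1 - w))%C with ((f 1, g 1) : C).
2:{ unfold f, g, Clog; rewrite Carg_atan by now apply Re_1_minus_pos.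
    now rewrite Cmult_1_l. }
assert (H0 : (1 - 0%R * w)%C = RtoC 1) by ring.
apply is_series_C_components.
- apply (is_series_ext (fun k => Re (w ^ S k)%C / INR (S k))).
  { intros k; now rewrite Hc, re_scal_r. }
  apply (is_series_taylor f (fun t => Re (dl t)) _ (/ (1 - Cmod w)) (Cmod w)); [lra| | |].
  + unfold f; rewrite H0, Cmod_1, ln_1; ring.
  + intros t Ht; now apply is_derive_ln_Cmod_ray, Hpos.
  + intros n t Ht; eapply Rle_trans; [|now apply Hrem, Ht].
    eapply Rle_trans; [|apply Rabs_Re_le_Cmod].
    set (s := fun k => (w ^ S k * RtoC (t ^ k))%C).
    change (Re (dl t - @sum_n C_NormedModule s n)%C)
      with (Re (dl t) - Re (@sum_n C_NormedModule s n)).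
    rewrite Re_sum_n; apply Req_le; do 2 f_equal.
    apply sum_n_ext; intros k; unfold s; now rewrite re_scal_r.
- apply (is_series_ext (fun k => Im (w ^ S k)%C / INR (S k))).
  { intros k; now rewrite Hc, im_scal_r. }
  apply (is_series_taylor g (fun t => Im (dl t)) _ (/ (1 - Cmod w)) (Cmod w)); [lra| | |].
  + unfold g; rewrite H0; simpl; unfold Rdiv; rewrite Rmult_0_l, atan_0; ring.
  + intros t Ht; now apply is_derive_atan_ray, Hpos.
  + intros n t Ht; eapply Rle_trans; [|now apply Hrem, Ht].
    eapply Rle_trans; [|apply Rabs_Im_le_Cmod].
    set (s := fun k => (w ^ S k * RtoC (t ^ k))%C).
    change (Im (dl t - @sum_n C_NormedModule s n)%C)
      with (Im (dl t) - Im (@sum_n C_NormedModule s n)).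
    rewrite Im_sum_n; apply Req_le; do 2 f_equal.
    apply sum_n_ext; intros k; unfold s; now rewrite im_scal_r.
Qed.

(** * Exponentials of unconditional sums *)

Lemma Cexp_plus (a b : C) : Cexp (a + b) = (Cexp a * Cexp b)%C.
Proof.
destruct a, b; unfold Cexp; simpl.
rewrite exp_plus, cos_plus, sin_plus.
apply injective_projections; simpl; ring.
Qed.

Lemma continuous_Cexp (a : C) : filterlim Cexp (locally a) (locally (Cexp a)).
Proof.
assert (H1 : continuous (fun w : C => Re w) a) by apply continuous_fst.
assert (H2 : continuous (fun w : C => Im w) a) by apply continuous_snd.
assert (Hx : forall x, continuous exp x)
  by (intros x; apply (ex_derive_continuous exp); auto_derive; trivial).
assert (Hc : forall x, continuous cos x)
  by (intros x; apply (ex_derive_continuous cos); auto_derive; trivial).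
assert (Hs : forall x, continuous sin x)
  by (intros x; apply (ex_derive_continuous sin); auto_derive; trivial).
apply (filterlim_C_components (locally a) Cexp (Cexp a)).
- apply (continuous_mult (fun w : C => exp (Re w)) (fun w : C => cos (Im w))).
  + now apply (continuous_comp (fun w : C => Re w) exp).
  + now apply (continuous_comp (fun w : C => Im w) cos).
- apply (continuous_mult (fun w : C => exp (Re w)) (fun w : C => sin (Im w))).
  + now apply (continuous_comp (fun w : C => Re w) exp).
  + now apply (continuous_comp (fun w : C => Im w) sin).
Qed.

Definition list_Csum {T : Type} (g : T -> C) (L : list T) : C :=
  fold_right (fun t s => g t + s)%C (RtoC 0) L.

Lemma list_Cprod_Cexp {T : Type} (A : T -> Prop) (f g : T -> C) (L : list T) :
  (forall p, A p -> f p = Cexp (g p)) -> List.Forall A L ->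
  list_Cprod f L = Cexp (list_Csum g L).
Proof.
intros Hf HL; induction HL as [|p L Hp _ IH]; simpl.
- unfold Cexp; simpl; rewrite exp_0, cos_0, sin_0.
  apply injective_projections; simpl; ring.
- now rewrite Cexp_plus, IH, Hf.
Qed.

Lemma list_Csum_opp {T : Type} (g : T -> C) (L : list T) :
  list_Csum (fun p => - g p)%C L = (- list_Csum g L)%C.
Proof.
induction L as [|p L IH]; simpl; [|rewrite IH]; ring.
Qed.

(** Only continuity and additivity of [Cexp] enter: no logarithm of a product is taken, so no branch
    has to be tracked. *)
Lemma is_prod_Cexp {T : Type} (A : T -> Prop) (f g : T -> C) (l : C) :
  (forall p, A p -> f p = Cexp (g p)) ->
  filterlim (list_Csum g) (finite_subsets A) (locally l) ->
  is_prod A f (Cexp l).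
Proof.
intros Hf Hl P HP.
destruct (Hl _ (continuous_Cexp l P HP)) as [L0 [HA HL]].
exists L0; split; [exact HA|]; intros L HN HF Hi.
unfold filtermap in HL; rewrite (list_Cprod_Cexp A f g L Hf HF); now apply HL.
Qed.

(** * Lattice points and their reduction to coprime pairs *)

Definition pair_eq_dec (p q : nat * nat) : {p = q} + {p <> q}.
Proof. decide equality; apply Nat.eq_dec. Defined.

(** The fraction a/b in lowest terms: the coprime pair on whose ray from the origin (a, b) lies. *)
Definition reduce (a b : nat) : nat * nat :=
  (a / Nat.gcd a b, b / Nat.gcd a b)%nat.

Lemma coprime_pair_reduce (a b : nat) (ha : (1 <= a)%nat) (hab : (a <= b)%nat) :
  coprime_pair (reduce a b).
Proof.
unfold coprime_pair, reduce.
assert (Hd : Nat.gcd a b <> 0%nat) by (intros E; apply Nat.gcd_eq_0_l in E; lia).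
pose proof (Nat.gcd_div_gcd a b _ Hd eq_refl) as Hg.
pose proof (Nat.gcd_divide_l a b) as [u Hu].
pose proof (Nat.gcd_divide_r a b) as [v Hv].
set (d := Nat.gcd a b) in *; clearbody d; subst a b.
rewrite !Nat.div_mul in * by assumption.
repeat split; [nia|nia|nia|exact Hg].
Qed.

(** The multiplier k is the gcd of a and b. This makes the triple (m, n, k) of a lattice point
    unique. *)
Lemma reduce_eq_iff (m n a b : nat) (hp : coprime_pair (m, n)) (ha : (1 <= a)%nat) :
  reduce a b = (m, n) <-> exists k, a = (m * k)%nat /\ b = (n * k)%nat.
Proof.
destruct hp as [Hm [Hn [_ Hg]]]; unfold reduce; split.
- intros E; injection E as E1 E2; exists (Nat.gcd a b).
  assert (Hd : Nat.gcd a b <> 0%nat) by (intros E; apply Nat.gcd_eq_0_l in E; lia).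
  pose proof (Nat.gcd_divide_l a b) as [u Hu].
  pose proof (Nat.gcd_divide_r a b) as [v Hv].
  subst m n; split.
  + rewrite Hu at 2; now rewrite Nat.div_mul by assumption.
  + rewrite Hv at 2; now rewrite Nat.div_mul by assumption.
- intros [k [-> ->]].
  assert (k <> 0%nat) by (intros ->; lia).
  rewrite Nat.gcd_mul_mono_r, Hg, Nat.mul_1_l.
  now rewrite !Nat.div_mul by assumption.
Qed.

(* Indices are shifted by one: [j], [i] stand for the lattice point (j + 1, i + 1). *)
Definition lattice_term (z : C) (j i : nat) : C :=
  (RtoC (INR (S j) ^ 2 / INR (S i) ^ 3) * z ^ S i)%C.

(** The share of level i + 1 that lies on the ray of [p]; summed over [i] it gives the logarithm of
    the factor at [p]. *)
Definition fiber_term (z : C) (p : nat * nat) (i : nat) : C :=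
  @sum_n C_NormedModule
    (fun j => if pair_eq_dec (reduce (S j) (S i)) p then lattice_term z j i else RtoC 0) i.

Definition level_term (z : C) (i : nat) : C :=
  @sum_n C_NormedModule (fun j => lattice_term z j i) i.

(** Each lattice point has a single reduction, so a list without duplicates counts it at most
    once. *)
Lemma list_Csum_fiber_term (z : C) (i : nat) (L : list (nat * nat)) (hL : NoDup L) :
  list_Csum (fun p => fiber_term z p i) L =
  @sum_n C_NormedModule
    (fun j => if in_dec pair_eq_dec (reduce (S j) (S i)) L
              then lattice_term z j i else RtoC 0) i.
Proof.
induction hL as [|p L Hp _ IH]; cbn [list_Csum fold_right].
- symmetry; rewrite (sum_n_ext _ (fun _ => zero)) by (intros j; now destruct in_dec).
  apply (sum_n_m_const_zero (G := C_NormedModule)).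
- unfold list_Csum in IH; rewrite IH; unfold fiber_term.
  change Cplus with (@plus C_NormedModule); rewrite <- sum_n_plus.
  apply sum_n_ext; intros j; change (@plus C_NormedModule) with Cplus.
  destruct (pair_eq_dec (reduce (S j) (S i)) p) as [E|E];
  destruct (in_dec pair_eq_dec (reduce (S j) (S i)) L) as [F|F];
  destruct (in_dec pair_eq_dec (reduce (S j) (S i)) (p :: L)) as [G|G];
  simpl in G; try apply Cplus_0_r; try apply Cplus_0_l; exfalso.
  + now subst p.
  + now subst p.
  + apply G; now left.
  + apply G; now right.
  + destruct G; congruence.
Qed.

(** * Level sums: size, closed form and series *)

Lemma sum_squares (i : nat) :
  sum_n (fun j => INR (S j) ^ 2) i = INR (S i) * (INR (S i) + 1) * (2 * INR (S i) + 1) / 6.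
Proof.
induction i as [|i IH]; [rewrite sum_O; simpl; field|].
rewrite sum_Sn, IH, !S_INR; unfold plus; simpl; field.
Qed.

(** With N = i + 1 the claim is (N + 1)(2N + 1) <= 6 N^2, an equality at N = 1. Bounding the sum of
    moduli also controls any selection of points from the level. *)
Lemma sum_Cmod_lattice_term_le (z : C) (i : nat) :
  sum_n (fun j => Cmod (lattice_term z j i)) i <= Cmod z ^ S i.
Proof.
assert (HN : 1 <= INR (S i)) by (rewrite S_INR; pose proof (pos_INR i); lra).
assert (HN3 : 0 < INR (S i) ^ 3) by (apply pow_lt; lra).
pose proof (pow_le _ (S i) (Cmod_ge_0 z)) as Hz.
rewrite (sum_n_ext _ (fun j => mult (Cmod z ^ S i / INR (S i) ^ 3) (INR (S j) ^ 2))).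
2:{ intros j; unfold lattice_term; rewrite Cmod_mult, Cmod_pow, Cmod_R, Rabs_pos_eq.
    - change (INR (S j) ^ 2 / INR (S i) ^ 3 * Cmod z ^ S i
              = Cmod z ^ S i / INR (S i) ^ 3 * INR (S j) ^ 2 :> R); field; lra.
    - apply Rmult_le_pos; [apply pow2_ge_0|]; now apply Rlt_le, Rinv_0_lt_compat. }
rewrite sum_n_mult_l, sum_squares; change (@mult R_Ring) with Rmult.
set (N := INR (S i)) in *; set (r := Cmod z ^ S i) in *.
replace (r / N ^ 3 * (N * (N + 1) * (2 * N + 1) / 6))
  with (r * ((N + 1) * (2 * N + 1) / (6 * N ^ 2))) by (field; lra).
apply Rle_trans with (r * 1); [apply Rmult_le_compat_l; [exact Hz|]|lra].
apply Rle_div_l; nra.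
Qed.

(** The terms in 1/N^2, 1/N and 1 of the averaged sum of squares produce the dilogarithm, the
    logarithm and the geometric series. *)
Lemma level_term_eq (z : C) (i : nat) :
  level_term z i =
  (1 / 6 * Li2_term z i + 1 / 2 * (z ^ S i / RtoC (INR (S i))) + 1 / 3 * z ^ S i)%C.
Proof.
assert (HN : INR (S i) <> 0) by now apply not_0_INR.
assert (HNC : RtoC (INR (S i)) <> RtoC 0) by (intros E; now apply RtoC_inj in E).
unfold level_term, lattice_term, Li2_term.
rewrite (sum_n_mult_r (K := C_Ring) (z ^ S i)%C
  (fun j => RtoC (INR (S j) ^ 2 / INR (S i) ^ 3))).
change (@mult C_Ring) with Cmult.
assert (E : forall a : nat -> R,
  @sum_n C_Ring (fun j => RtoC (a j)) i = RtoC (sum_n a i)).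
{ intros a; generalize i; intros n; induction n as [|n IH]; [now rewrite !sum_O|].
  rewrite !sum_Sn, IH; symmetry; apply RtoC_plus. }
rewrite E; unfold Rdiv.
rewrite (sum_n_mult_r (K := R_Ring) (/ INR (S i) ^ 3)), sum_squares.
change (@mult R_Ring) with Rmult; set (N := INR (S i)) in *.
replace (N * (N + 1) * (2 * N + 1) / 6 * / N ^ 3) with
  (1 / 6 * / N ^ 2 + 1 / 2 * / N + 1 / 3) by (field; exact HN).
rewrite !RtoC_plus, !RtoC_mult, !RtoC_inv, RtoC_pow, !RtoC_div by (try apply pow_nonzero; lra).
field; exact HNC.
Qed.

Lemma is_series_Cgeom (z : C) (hz : Cmod z < 1) :
  @is_series C_AbsRing C_NormedModule (fun i => z ^ S i)%C (z / (1 - z))%C.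
Proof.
assert (Hz : (1 - z)%C <> RtoC 0)
  by (pose proof (Re_1_minus_pos z hz) as H; intros E; rewrite E in H; simpl in H; lra).
set (c := (z / (1 - z))%C).
apply (filterlim_ext (fun n => plus (c : C_NormedModule) (scal (- c)%C (z ^ S n)%C))).
{ intros n; pose proof (Cgeom_sum_n z 1 n) as E.
  rewrite !Cmult_1_l in E.
  rewrite (sum_n_ext _ (fun k => z ^ S k)%C) in E
    by (intros k; rewrite pow1; apply Cmult_1_r).
  change (c + - c * z ^ S n = sum_n (fun k => z ^ S k) n)%C.
  transitivity ((z - z * z ^ S n) / (1 - z))%C; [unfold c; field; exact Hz|].
  rewrite <- E; unfold Cdiv; rewrite Cmult_comm, Cmult_assoc, Cinv_l by exact Hz.
  apply Cmult_1_l. }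
assert (HL : filterlim (fun n => plus (c : C_NormedModule) (scal (- c)%C (z ^ S n)%C))
  eventually (locally (plus (c : C_NormedModule) (scal (- c)%C zero)))).
{ eapply filterlim_comp_2; [apply filterlim_const| |apply (filterlim_plus (V := C_NormedModule))].
  eapply filterlim_comp; [|apply (filterlim_scal_r (V := C_NormedModule))].
  apply (filterlim_norm_zero (V := C_NormedModule)).
  change (is_lim_seq (fun n => Cmod (z ^ S n)) 0).
  apply (is_lim_seq_ext (fun n => Cmod z ^ S n)).
  { intros n; symmetry; apply Cmod_pow. }
  apply (is_lim_seq_incr_1 (fun n => Cmod z ^ n)), is_lim_seq_geom.
  rewrite Rabs_pos_eq; [exact hz|apply Cmod_ge_0]. }
rewrite scal_zero_r, plus_zero_r in HL; exact HL.
Qed.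

Lemma is_series_level_term (z : C) (hz : Cmod z < 1) :
  @is_series C_AbsRing C_NormedModule (level_term z)
    (1 / 6 * Li2 z + 1 / 2 * (- Clog (1 - z)) + 1 / 3 * (z / (1 - z)))%C.
Proof.
eapply is_series_ext; [intros i; symmetry; apply level_term_eq|].
apply (is_series_plus (V := C_NormedModule)); [apply (is_series_plus (V := C_NormedModule))|].
- apply (is_series_scal (V := C_NormedModule)); now apply is_series_Li2.
- apply (is_series_scal (V := C_NormedModule)); now apply is_series_Clog.
- apply (is_series_scal (V := C_NormedModule)); now apply is_series_Cgeom.
Qed.

(** * Summation along the ray of one coprime pair *)

Lemma sum_n_single {G : AbelianMonoid} (a : nat -> G) (j n : nat) :
  (forall k, k <> j -> a k = zero) -> (j <= n)%nat -> sum_n a n = a j.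
Proof.
intros Ha Hj.
assert (H : forall q, sum_n a q = if le_dec j q then a j else zero).
{ induction q as [|q IH].
  - rewrite sum_O; destruct (le_dec j 0) as [H|H]; [f_equal; lia|apply Ha; lia].
  - rewrite sum_Sn, IH.
    destruct (le_dec j q), (le_dec j (S q)); try lia.
    + rewrite (Ha (S q)) by lia; apply plus_zero_r.
    + rewrite plus_zero_l; f_equal; lia.
    + rewrite (Ha (S q)) by lia; apply plus_zero_r. }
rewrite H; now destruct (le_dec j n).
Qed.

(* The values of [v] are moved to the positions [i] with [n] dividing [i + 1]; the
   other positions are filled with zeros. *)
Lemma is_series_spread {K : AbsRing} {V : NormedModule K} (v : nat -> V) (l : V)
  (n : nat) (hn : (1 <= n)%nat) :
  is_series v l ->
  is_series (fun i => if (S i mod n =? 0)%nat then v (pred (S i / n)) else zero) l.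
Proof.
intros Hv.
(* [W q] adds the first [q] terms of [v], whereas [sum_n v q] would add q + 1. *)
set (W := fun q => match q with O => zero | S q' => sum_n v q' end).
assert (HW : forall M,
  sum_n (fun i => if (S i mod n =? 0)%nat then v (pred (S i / n)) else zero) M
  = W (S M / n)%nat).
{ assert (Hstep : forall M x, x = W (M / n)%nat ->
    plus x (if (S M mod n =? 0)%nat then v (pred (S M / n)) else zero)
    = W (S M / n)%nat).
  { intros M x ->.
    pose proof (Nat.div_mod_eq M n) as E1; pose proof (Nat.div_mod_eq (S M) n) as E2.
    pose proof (Nat.mod_upper_bound M n ltac:(lia)).
    pose proof (Nat.mod_upper_bound (S M) n ltac:(lia)).
    destruct (Nat.eqb_spec (S M mod n) 0) as [E|E].
    - assert (Hq : (S M / n = S (M / n))%nat) by nia.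
      rewrite Hq; unfold W; simpl pred.
      destruct (M / n)%nat as [|q]; [now rewrite plus_zero_l, sum_O|now rewrite sum_Sn].
    - assert (Hq : (S M / n = M / n)%nat) by nia.
      now rewrite Hq, plus_zero_r. }
  induction M as [|M IH].
  - rewrite sum_O, <- (Hstep 0%nat zero); [now rewrite plus_zero_l|].
    now rewrite Nat.Div0.div_0_l.
  - rewrite sum_Sn; now apply Hstep. }
intros P HP; destruct (Hv P HP) as [N HN].
(* From this index on, at least N + 1 terms of [v] have been collected. *)
exists (n * S N)%nat; intros M HM; rewrite HW.
assert (Hq : (S N <= S M / n)%nat) by (apply Nat.div_le_lower_bound; lia).
destruct (S M / n)%nat as [|q]; [lia|apply HN; lia].
Qed.

(** Level nk meets the ray of (m, n) only in (mk, nk), whose term is (m^2/n^3) (z^n)^k / k. Writing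
    k as [S (pred _)] fits the indexing of the logarithm series. *)
Lemma fiber_term_eq (z : C) (m n i : nat) (hp : coprime_pair (m, n)) :
  fiber_term z (m, n) i =
  if (S i mod n =? 0)%nat
  then (RtoC (INR m ^ 2 / INR n ^ 3) *
        ((z ^ n) ^ S (pred (S i / n)) / RtoC (INR (S (pred (S i / n))))))%C
  else RtoC 0.
Proof.
pose proof hp as [Hm [Hn [Hmn _]]]; unfold fiber_term.
destruct (Nat.eqb_spec (S i mod n) 0) as [E|E].
- apply Nat.Div0.mod_divides in E; destruct E as [k Hk].
  assert (Hk0 : (1 <= k)%nat) by nia.
  assert (Hd : (S i / n = k)%nat) by (rewrite Hk, Nat.mul_comm; apply Nat.div_mul; lia).
  rewrite Hd, Nat.succ_pred by lia.
  (* The surviving index is mk - 1, within range because m <= n. *)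
  rewrite (sum_n_single (G := C_NormedModule) _ (pred (m * k))).
  + rewrite Nat.succ_pred by nia.
    destruct (pair_eq_dec _ _) as [F|F].
    2:{ exfalso; apply F, reduce_eq_iff; [assumption|nia|now exists k]. }
    unfold lattice_term; rewrite Nat.succ_pred, Hk, !mult_INR, Cpow_mult_r by nia.
    assert (Hk' : INR k <> 0) by (apply not_0_INR; lia).
    assert (Hn' : INR n <> 0) by (apply not_0_INR; lia).
    replace ((INR m * INR k) ^ 2 / (INR n * INR k) ^ 3)
      with (INR m ^ 2 / INR n ^ 3 * / INR k) by (field; now split).
    rewrite RtoC_mult, RtoC_inv by assumption; unfold Cdiv; ring.
  + intros j Hj; destruct (pair_eq_dec _ _) as [F|F]; [|reflexivity].
    apply reduce_eq_iff in F; [|assumption|lia].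
    destruct F as [k' [F1 F2]]; exfalso; assert (k' = k) by nia; subst k'; lia.
  + nia.
- rewrite (sum_n_ext _ (fun _ => zero)); [apply (sum_n_m_const_zero (G := C_NormedModule))|].
  intros j; destruct (pair_eq_dec _ _) as [F|F]; [|reflexivity].
  apply reduce_eq_iff in F; [|assumption|lia].
  destruct F as [k' [_ F2]]; exfalso; apply E; rewrite F2, Nat.mul_comm.
  apply Nat.Div0.mod_mul.
Qed.

Lemma Cmod_pow_lt_1 (z : C) (n : nat) (hz : Cmod z < 1) (hn : (1 <= n)%nat) :
  Cmod (z ^ n) < 1.
Proof.
rewrite Cmod_pow; destruct n as [|n]; [lia|].
apply pow_lt_1_compat; [split; [apply Cmod_ge_0|exact hz]|lia].
Qed.

(** A logarithm of the factor of the first product, written with -log(1 - z^n) so that the power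
    series applies directly. *)
Definition log_factor (z : C) (p : nat * nat) : C :=
  let (m, n) := p in
  (RtoC (INR m ^ 2 / INR n ^ 3) * - Clog (1 - z ^ n))%C.

Lemma is_series_fiber_term (z : C) (p : nat * nat) (hz : Cmod z < 1)
  (hp : coprime_pair p) :
  @is_series C_AbsRing C_NormedModule (fiber_term z p) (log_factor z p).
Proof.
destruct p as [m n]; pose proof hp as [_ [Hn _]].
eapply is_series_ext; [intros i; symmetry; now apply fiber_term_eq|].
apply (is_series_spread (V := C_NormedModule)
  (fun k => RtoC (INR m ^ 2 / INR n ^ 3) * ((z ^ n) ^ S k / RtoC (INR (S k))))%C);
  [exact Hn|].
apply (is_series_scal (V := C_NormedModule)), is_series_Clog.
now apply Cmod_pow_lt_1.
Qed.

Lemma is_series_list_Csum {T : Type} (u : T -> nat -> C) (g : T -> C) (L : list T) :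
  List.Forall (fun p => @is_series C_AbsRing C_NormedModule (u p) (g p)) L ->
  @is_series C_AbsRing C_NormedModule (fun i => list_Csum (fun p => u p i) L)
    (list_Csum g L).
Proof.
intros HL; induction HL as [|p L Hp _ IH].
- apply (filterlim_ext (fun _ => zero)); [|apply filterlim_const].
  intros n; symmetry; apply (sum_n_m_const_zero (G := C_NormedModule)).
- now apply (is_series_plus (V := C_NormedModule)).
Qed.

(** * Tail estimate and unconditional summation *)

Lemma is_series_tail_bound (d : nat -> C) (l : C) (r : R) (K : nat) (hr : 0 <= r < 1) :
  @is_series C_AbsRing C_NormedModule d l ->
  (forall i, (i < K)%nat -> d i = RtoC 0) ->
  (forall i, Cmod (d i) <= r ^ S i) ->
  Cmod l <= r ^ K / (1 - r).
Proof.
intros Hd H0 Hb.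
(* One factor r is given away: r^i in place of r^(i+1). *)
set (b := fun i => if lt_dec i K then 0 else r ^ i).
assert (HB : forall n, sum_n b n <= r ^ K / (1 - r)).
{ intros n; apply Rle_div_r; [lra|].
  assert (H1 : forall q : nat, (q < K)%nat -> sum_n b q = 0).
  { induction q as [|q IH]; intros Hq.
    - rewrite sum_O; unfold b; destruct (lt_dec 0 K); [trivial|lia].
    - rewrite sum_Sn, IH by lia; unfold b; destruct (lt_dec (S q) K); [|lia].
      apply Rplus_0_l. }
  (* Telescoping of the geometric sum; the maximum covers n < K, where the sum is empty. *)
  assert (H2 : sum_n b n * (1 - r) <= r ^ K - r ^ Nat.max K (S n)).
  { induction n as [|n IH].
    - rewrite sum_O; unfold b; destruct (lt_dec 0 K).
      + replace (Nat.max K 1) with K by lia; lra.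
      + assert (K = 0%nat) as -> by lia; simpl; lra.
    - destruct (lt_dec (S n) K) as [Hn|Hn].
      + rewrite H1 by exact Hn; replace (Nat.max K (S (S n))) with K by lia; lra.
      + rewrite sum_Sn; change plus with Rplus; unfold b at 2.
        destruct (lt_dec (S n) K); [lia|].
        replace (Nat.max K (S (S n))) with (S (S n)) by lia.
        replace (Nat.max K (S n)) with (S n) in IH by lia.
        simpl in *; lra. }
  pose proof (pow_le r (Nat.max K (S n)) (proj1 hr)); lra. }
apply (is_lim_seq_le (fun n => Cmod (@sum_n C_NormedModule d n)) (fun _ => r ^ K / (1 - r))
   (Cmod l) (r ^ K / (1 - r))).
- intros n; eapply Rle_trans; [|apply HB].
  eapply Rle_trans; [apply (norm_sum_n_m (V := C_NormedModule))|].
  apply sum_n_m_le; intros i; unfold b; destruct (lt_dec i K) as [Hi|Hi].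
  + rewrite H0 by exact Hi; apply Req_le, Cmod_0.
  + eapply Rle_trans; [apply Hb|]; simpl.
    pose proof (pow_le r i (proj1 hr)); nra.
- exact (filterlim_comp _ _ _ _ _ _ _ _ Hd
    (filterlim_norm (V := C_NormedModule) (l : C_NormedModule))).
- apply is_lim_seq_const.
Qed.

(** Reducing every lattice point of levels 1 to K repeats pairs, which is harmless since
    [finite_subsets] only tests inclusion of this list. *)
Definition pairs_upto (K : nat) : list (nat * nat) :=
  flat_map (fun i => map (fun j => reduce (S j) (S i)) (seq 0 (S i))) (seq 0 K).

Lemma pairs_upto_coprime (K : nat) : List.Forall coprime_pair (pairs_upto K).
Proof.
apply List.Forall_forall; intros p Hp.
apply in_flat_map in Hp; destruct Hp as [i [_ Hp]].
apply in_map_iff in Hp; destruct Hp as [j [<- Hj]].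
apply in_seq in Hj; apply coprime_pair_reduce; lia.
Qed.

Lemma in_pairs_upto (K i j : nat) (hj : (j <= i)%nat) (hi : (i < K)%nat) :
  In (reduce (S j) (S i)) (pairs_upto K).
Proof.
apply in_flat_map; exists i; split; [apply in_seq; lia|].
apply in_map_iff; exists j; split; [reflexivity|apply in_seq; lia].
Qed.

(** Exhibits the error at one level as a sum over the points not covered by [L], to which the bound
    on moduli applies. *)
Lemma level_term_minus_fibers (z : C) (i : nat) (L : list (nat * nat)) (hL : NoDup L) :
  (level_term z i - list_Csum (fun p => fiber_term z p i) L)%C =
  @sum_n C_NormedModule
    (fun j => if in_dec pair_eq_dec (reduce (S j) (S i)) L
              then RtoC 0 else lattice_term z j i) i.
Proof.
rewrite list_Csum_fiber_term by exact hL; unfold level_term.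
set (s := fun j => if in_dec pair_eq_dec (reduce (S j) (S i)) L
                   then lattice_term z j i else RtoC 0).
set (t := fun j => if in_dec pair_eq_dec (reduce (S j) (S i)) L
                   then RtoC 0 else lattice_term z j i).
rewrite (sum_n_ext (fun j => lattice_term z j i)
  (fun j => @plus C_NormedModule (t j) (s j))).
- rewrite sum_n_plus.
  change (@sum_n C_NormedModule t i + @sum_n C_NormedModule s i
          - @sum_n C_NormedModule s i = @sum_n C_NormedModule t i)%C; ring.
- intros j; unfold s, t; destruct in_dec; symmetry; [apply Cplus_0_l|apply Cplus_0_r].
Qed.

Lemma filterlim_list_Csum_log_factor (z : C) (hz : Cmod z < 1) :
  filterlim (list_Csum (log_factor z)) (finite_subsets coprime_pair)
    (locally (1 / 6 * Li2 z + 1 / 2 * (- Clog (1 - z)) + 1 / 3 * (z / (1 - z)))%C).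
Proof.
set (l := (_ + _ + _)%C).
pose proof (conj (Cmod_ge_0 z) hz) as Hr.
apply (filterlim_locally_ball_norm (U := C_NormedModule)); intros eps.
assert (HK : exists K, Cmod z ^ K / (1 - Cmod z) < eps).
{ destruct (pow_lt_1_zero (Cmod z)) with (y := eps * (1 - Cmod z)) as [K HK].
  - rewrite Rabs_pos_eq; lra.
  - apply Rmult_lt_0_compat; [apply cond_pos|lra].
  - exists K; apply Rlt_div_l; [lra|].
    specialize (HK K (Nat.le_refl K)); rewrite Rabs_pos_eq in HK; [exact HK|].
    now apply pow_le. }
destruct HK as [K HK].
exists (pairs_upto K); split; [apply pairs_upto_coprime|].
intros L HN HF Hi.
apply Rle_lt_trans with (2 := HK).
change (Cmod (list_Csum (log_factor z) L - l) <= Cmod z ^ K / (1 - Cmod z)).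
replace (list_Csum (log_factor z) L - l)%C with (- (l - list_Csum (log_factor z) L))%C by ring.
rewrite Cmod_opp.
(* The error is itself a series over levels: it vanishes below index [K], where every point reduces
   into [L], and is at most |z|^(i+1) at every index [i]. *)
apply (is_series_tail_bound
  (fun i => level_term z i - list_Csum (fun p => fiber_term z p i) L)%C); [exact Hr| | |].
- apply (is_series_minus (V := C_NormedModule)); [now apply is_series_level_term|].
  apply is_series_list_Csum; eapply List.Forall_impl; [|exact HF].
  intros p Hp; now apply is_series_fiber_term.
- intros i Hik; rewrite list_Csum_fiber_term by exact HN; unfold level_term.
  apply (proj1 (Ceq_minus _ _)), (sum_n_m_ext_loc (G := C_NormedModule)); intros j [_ Hj].
  destruct in_dec as [_|F]; [reflexivity|].
  exfalso; apply F, Hi, in_pairs_upto; lia.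
- intros i; rewrite level_term_minus_fibers by exact HN.
  eapply Rle_trans; [apply (norm_sum_n_m (V := C_NormedModule))|].
  eapply Rle_trans; [|apply sum_Cmod_lattice_term_le].
  apply sum_n_m_le; intros j; change norm with Cmod; destruct in_dec; [|lra].
  rewrite Cmod_0; apply Cmod_ge_0.
Qed.

(** * From the sum of logarithms to the two products *)

Theorem theorem23 (z : C) (hz : Cmod z < 1) :
  is_prod coprime_pair
    (fun p : nat * nat => let (m, n) := p in
       Cpower (1 / (1 - z ^ n))%C (RtoC (INR m ^ 2 / INR n ^ 3)))
    (Csqrt (1 / (1 - z)) * Cexp (1 / 6 * Li2 z + 1 / 3 * (z / (1 - z))))%C
  /\
  is_prod coprime_pair
    (fun p : nat * nat => let (m, n) := p in
       Cpower (1 - z ^ n)%C (RtoC (INR m ^ 2 / INR n ^ 3)))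
    (Csqrt (1 - z) * Cexp (- (1 / 6) * Li2 z - 1 / 3 * (z / (1 - z))))%C.
Proof.
pose proof (filterlim_list_Csum_log_factor z hz) as HL.
assert (Hpos : forall n, (1 <= n)%nat -> 0 < Re (1 - z ^ n)%C)
  by (intros n Hn; now apply Re_1_minus_pos, Cmod_pow_lt_1).
assert (Hd : Re (1 - z)%C > 0) by now apply Re_1_minus_pos.
(* Each right-hand side becomes one exponential, with the square root contributing half a logarithm
   to the exponent. *)
unfold Csqrt, Cpower; rewrite <- !Cexp_plus, Clog_inv by exact Hd.
split.
- match goal with |- is_prod _ _ (Cexp ?e) => set (s := e) end.
  apply (is_prod_Cexp _ _ (log_factor z)).
  + intros [m n] [_ [Hn _]]; unfold log_factor; now rewrite Clog_inv by now apply Hpos.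
  + eapply filterlim_ext; [reflexivity|].
    replace s with (1 / 6 * Li2 z + 1 / 2 * (- Clog (1 - z)) + 1 / 3 * (z / (1 - z)))%C;
      [exact HL|].
    (* The exponent 1/2 in [Csqrt] is a real quotient embedded in [C]; it must be made a complex
       quotient to match. *)
    unfold s; rewrite RtoC_div by lra; unfold Cdiv; ring.
- match goal with |- is_prod _ _ (Cexp ?e) => set (s := e) end.
  (* The second product has the opposite logarithms, so its sum is the negated limit. *)
  apply (is_prod_Cexp _ _ (fun p => - log_factor z p)%C).
  + intros [m n] _; unfold log_factor; f_equal; ring.
  + eapply filterlim_ext; [intros L; symmetry; apply list_Csum_opp|].
    replace s with
      (- (1 / 6 * Li2 z + 1 / 2 * (- Clog (1 - z)) + 1 / 3 * (z / (1 - z))))%C.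
    * eapply filterlim_comp; [exact HL|apply (filterlim_opp (V := C_NormedModule))].
    * unfold s; rewrite RtoC_div by lra; unfold Cdiv; ring.
Qed.
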